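(* Let $q\in K^*$ be not a root of unity. Then $$\mathrm{Der}(T_q(2))=\mathrm{IDer}(T_q(2))\oplus KD_{11}\oplus KD_{12}\oplus KD_{22}\oplus KD_{11,(0,0,1)}\oplus KD_{22,(1,0,0)}.$$ In particular, $\dim_K(\mathrm{HH}^1(T_q(2)))=5$.
   Context: $K$ is a field of characteristic different from $2$. For an algebra $A$: $\mathrm{Der}(A)$ is the Lie algebra of $K$-linear derivations, $\mathrm{IDer}(A)$ the ideal of inner derivations, and $\mathrm{HH}^1(A)=\mathrm{Der}(A)/\mathrm{IDer}(A)$. $T_q(2)$ is the unital associative $K$-algebra generated by $a_{11},a_{12},a_{22}$ with relations $a_{22}a_{12}=qa_{12}a_{22}$, $a_{11}a_{12}=qa_{12}a_{11}$, $a_{11}a_{22}=a_{22}a_{11}$. For $(s,t)\in\{(1,1),(1,2),(2,2)\}$ and $\nu=(\nu_{11},\nu_{12},\nu_{22})\in\mathbb N^3$, $D_{st,\nu}$ denotes (when it exists) the derivation of $T_q(2)$ sending $a_{st}$ to $a_{11}^{\nu_{11}}a_{12}^{\nu_{12}}a_{22}^{\nu_{22}}$ and the other two generators to $0$. Moreover $D_{11}=D_{11,(1,0,0)}$, $D_{12}=D_{12,(0,1,0)}$, $D_{22}=D_{22,(0,0,1)}$. All five derivations appearing in the claim exist. ($\mathbb N$ includes $0$.) *)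

(* Defs.v *)
From HB Require Import structures.
From mathcomp Require Import all_boot all_order all_algebra.
From mathcomp Require Import generic_quotient ring_quotient.
From mathcomp Require Import boolp classical_sets functions.
From mathcomp Require Import monalg.

(* MathComp, with the classical layer of MathComp-Analysis and the monoid
   algebras of multinomials. *)

Set Implicit Arguments.
Unset Strict Implicit.
Unset Printing Implicit Defensive.

Import GRing.Theory.

Local Open Scope ring_scope.
Local Open Scope quotient_scope.
Local Open Scope classical_set_scope.

Section QuotientModule.
Variables (K : pzRingType) (V : lmodType K) (W : submodClosed V).

Lemma submodClosed_oppr_closed : oppr_closed W.
Proof. by move=> x xW; rewrite -scaleN1r rpredZ. Qed.

Definition zmodClosed_of_submodClosed : zmodClosed V :=
  HB.pack (GRing.SubmodClosed.sort W)
    (GRing.isOppClosed.Build V (GRing.SubmodClosed.sort W)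
       submodClosed_oppr_closed).

(* The quotient module V / W; the library only makes V / W a zmodType. *)
Definition quotmod : Type := Quotient.quot zmodClosed_of_submodClosed.

HB.instance Definition _ := GRing.Zmodule.on quotmod.
HB.instance Definition _ := EqQuotient.on quotmod.

Definition quotmod_scale (c : K) := lift_op1 quotmod ( *:%R c).

Lemma pi_quotmod_eq (x y : V) :
  (\pi_quotmod x = \pi_quotmod y) <-> (x - y \in W).
Proof.
have -> : (x - y \in W) = (\pi_quotmod x == \pi_quotmod y).
  exact: (Quotient.idealrBE zmodClosed_of_submodClosed).
by split=> [->|/eqP].
Qed.

Lemma pi_quotmodD (x y : V) :
  \pi_quotmod (x + y) = \pi_quotmod x + \pi_quotmod y.
Proof. exact: Quotient.pi_add. Qed.

Lemma pi_quotmodZ c (x : V) :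
  \pi_quotmod (c *: x) = quotmod_scale c (\pi_quotmod x).
Proof.
unlock quotmod_scale; apply/pi_quotmod_eq; rewrite -scalerBr rpredZ //.
by apply/pi_quotmod_eq; rewrite reprK.
Qed.

Let scaleA a b x :
  quotmod_scale a (quotmod_scale b x) = quotmod_scale (a * b) x.
Proof. by rewrite -[x]reprK -!pi_quotmodZ scalerA. Qed.

Let scale1 : left_id 1 quotmod_scale.
Proof. by move=> x; rewrite -[x]reprK -pi_quotmodZ scale1r. Qed.

Let scaleDr : right_distributive quotmod_scale +%R.
Proof.
move=> a x y; rewrite -[x]reprK -[y]reprK.
by rewrite -!(pi_quotmodZ, pi_quotmodD) scalerDr.
Qed.

Let scaleDl x : {morph quotmod_scale^~ x : a b / a + b}.
Proof.
move=> a b; rewrite -[x]reprK.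
by rewrite -!(pi_quotmodZ, pi_quotmodD) scalerDl.
Qed.

HB.instance Definition _ :=
  GRing.Zmodule_isLmodule.Build K quotmod scaleA scale1 scaleDr scaleDl.

End QuotientModule.

Section LinearAlgebra.
Variables (K : fieldType) (V : lmodType K).

Definition has_dim (n : nat) : Prop := inhabited (Vector.axiom n V).

Definition line (v : V) : set V := range (fun c : K => c *: v).

(* V is the internal direct sum of the subspaces listed in U. *)
Definition internal_direct_sum (U : seq (set V)) : Prop :=
  forall v : V, exists! u : {ffun 'I_(size U) -> V},
    (forall i : 'I_(size U), nth set0 U i (u i)) /\ v = \sum_i u i.

End LinearAlgebra.

Section Derivations.
Variables (K : fieldType) (A : algType K).

Definition is_derivation (d : A -> A) : Prop :=
  linear d /\ forall x y, d (x * y) = d x * y + x * d y.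

Definition derivation : {pred A -> A} := fun d => `[< is_derivation d >].

Lemma derivation_submod_closed : submod_closed derivation.
Proof.
split=> [|c d e /asboolP[dl dM] /asboolP[el eM]]; apply/asboolP; split.
- by move=> c x y /=; rewrite scaler0 addr0.
- by move=> x y /=; rewrite mul0r mulr0 addr0.
- move=> b x y; rewrite !addrfctE !scalrfctE dl el !scalerDr !scalerA.
  by rewrite [c * b]mulrC -!addrA; congr (_ + _); rewrite addrCA.
- move=> x y; rewrite !addrfctE !scalrfctE dM eM scalerDr mulrDl mulrDr.
  by rewrite -scalerAl -scalerAr -!addrA; congr (_ + _); rewrite addrCA.
Qed.

HB.instance Definition _ :=
  GRing.isSubmodClosed.Build K (A -> A) derivation derivation_submod_closed.

Definition Der : Type := {d : A -> A | d \in derivation}.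

HB.instance Definition _ := [isSub of Der for @sval _ _].
HB.instance Definition _ := [Choice of Der by <:].
HB.instance Definition _ := [SubChoice_isSubLmodule of Der by <:].

Definition IDer : {pred Der} :=
  fun D => `[< exists a : A, val D = (fun x => a * x - x * a) >].

Lemma IDer_submod_closed : submod_closed IDer.
Proof.
split=> [|c D E /asboolP[a aD] /asboolP[b bE]]; apply/asboolP.
  by exists 0; apply/funext => x; rewrite raddf0 mul0r mulr0 subr0.
exists (c *: a + b); apply/funext => x.
rewrite linearP /= aD bE addrfctE scalrfctE mulrDl mulrDr -scalerAl -scalerAr.
by rewrite scalerBr opprD addrACA.
Qed.

HB.instance Definition _ :=
  GRing.isSubmodClosed.Build K Der IDer IDer_submod_closed.

(* Der A / IDer A as a K-vector space; the Lie bracket is not needed for its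
   dimension. *)
Definition HH1 : lmodType K := quotmod IDer.

End Derivations.

Arguments IDer {K} A _.

Section FreeAlgebra.
Variables (K : fieldType) (I : choiceType).

(* An alias, because the library makes {malg R[M]} an algType only for
   commutative M. *)
Definition freeAlg : Type := {malg K[{fmonom I}]}.

HB.instance Definition _ := GRing.Lalgebra.on freeAlg.

Definition freeVar (i : I) : freeAlg := << fmu i >>.

Lemma freeAlg_scaleAr (c : K) (x y : {malg K[{fmonom I}]}) :
  c *: (x * y) = x * (c *: y).
Proof.
have MUU (a b : K) (k l : {fmonom I}) :
    << a *g k >> * << b *g l >> = << a * b *g mmul k l >>
    :> {malg K[{fmonom I}]}.
  exact: fgmulUU.
have ZU (a : K) (k : {fmonom I}) :
    c *: << a *g k >> = << c * a *g k >> :> {malg K[{fmonom I}]}.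
  by rewrite -mul_malgC MUU mul1m.
rewrite [x](monalgE) [y](monalgE) !mulr_suml scaler_sumr.
apply: eq_bigr => k _.
rewrite [X in _ = _ * X]scaler_sumr !mulr_sumr scaler_sumr.
by apply: eq_bigr => l _; rewrite MUU !ZU MUU mulrCA.
Qed.

HB.instance Definition _ :=
  GRing.Lalgebra_isAlgebra.Build K freeAlg freeAlg_scaleAr.

End FreeAlgebra.

Definition two_sided_ideal (A : pzRingType) (J : set A) : Prop :=
  [/\ J 0, (forall x y, J x -> J y -> J (x - y)),
      (forall a x, J x -> J (a * x)) & (forall a x, J x -> J (x * a))].

Lemma mulr_subr_mulr (A : pzRingType) (x y z t : A) :
  x * y - z * t = x * (y - t) + (x - z) * t.
Proof. by rewrite mulrBr mulrBl addrA subrK. Qed.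

(* The indices of the generators a_11, a_12, a_22. *)
Definition i11 : 'I_3 := @Ordinal 3 0 isT.
Definition i12 : 'I_3 := @Ordinal 3 1 isT.
Definition i22 : 'I_3 := @Ordinal 3 2 isT.

Section Tq.
Variables (K : fieldType) (q : K).

Local Notation F := (freeAlg K 'I_3).
Local Notation M := {malg K[{fmonom 'I_3}]}.
Local Notation gX i := (freeVar K i : F).

Definition Tq_relators : set F :=
  [set gX i22 * gX i12 - q *: (gX i12 * gX i22);
       gX i11 * gX i12 - q *: (gX i12 * gX i11);
       gX i11 * gX i22 - gX i22 * gX i11].

(* The two-sided ideal generated by the relators. *)
Definition Tq_ideal : {pred F} :=
  fun x => `[< smallest (@two_sided_ideal F) Tq_relators x >].

Lemma Tq_idealP : two_sided_ideal [set` Tq_ideal].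
Proof.
split=> /=.
- by apply/asboolP => J [[]].
- move=> x y /asboolP xJ /asboolP yJ; apply/asboolP => J JP.
  by have [[_ JB _ _] _] := JP; apply: JB; [apply: xJ|apply: yJ].
- move=> a x /asboolP xJ; apply/asboolP => J JP.
  by have [[_ _ JM _] _] := JP; apply: JM; apply: xJ.
- move=> a x /asboolP xJ; apply/asboolP => J JP.
  by have [[_ _ _ JM] _] := JP; apply: JM; apply: xJ.
Qed.

Lemma Tq_idealMl a x : x \in Tq_ideal -> a * x \in Tq_ideal.
Proof. by case: Tq_idealP => _ _ + _; apply. Qed.

Lemma Tq_idealMr a x : x \in Tq_ideal -> x * a \in Tq_ideal.
Proof. by case: Tq_idealP => _ _ _; apply. Qed.

Lemma Tq_ideal_submod_closed : submod_closed Tq_ideal.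
Proof.
have [J0 JB _ _] := Tq_idealP; split=> // c x y xJ yJ.
rewrite -[y]opprK; apply: (JB); first by rewrite -mulr_algl; exact: Tq_idealMl.
by rewrite -[- y]add0r; exact: JB.
Qed.

HB.instance Definition _ :=
  GRing.isSubmodClosed.Build K F Tq_ideal Tq_ideal_submod_closed.

Definition Tq : Type := quotmod Tq_ideal.

HB.instance Definition _ := GRing.Lmodule.on Tq.
HB.instance Definition _ := EqQuotient.on Tq.

Definition Tq_one : Tq := \pi_Tq (1 : F).
Definition Tq_mul := lift_op2 Tq ( *%R : F -> F -> F).

Lemma pi_Tq_eq (x y : F) : (\pi_Tq x = \pi_Tq y) <-> (x - y \in Tq_ideal).
Proof. exact: pi_quotmod_eq. Qed.

Lemma pi_TqM (x y : F) : \pi_Tq (x * y) = Tq_mul (\pi_Tq x) (\pi_Tq y).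
Proof.
unlock Tq_mul; apply/pi_Tq_eq; rewrite mulr_subr_mulr rpredD //.
  by rewrite Tq_idealMl //; apply/pi_Tq_eq; rewrite reprK.
by rewrite Tq_idealMr //; apply/pi_Tq_eq; rewrite reprK.
Qed.

Lemma pi_Tq_linear : linear (\pi_Tq : F -> Tq).
Proof. by move=> c x y; rewrite [LHS]pi_quotmodD pi_quotmodZ. Qed.

Let pi_TqD (x y : F) : \pi_Tq (x + y) = \pi_Tq x + \pi_Tq y :> Tq.
Proof. exact: pi_quotmodD. Qed.

Let mulA : associative Tq_mul.
Proof.
move=> x y z; rewrite -[x]reprK -[y]reprK -[z]reprK.
by rewrite -!pi_TqM mulrA.
Qed.

Let mul1 : left_id Tq_one Tq_mul.
Proof. by move=> x; rewrite -[x]reprK -pi_TqM mul1r. Qed.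

Let mulx1 : right_id Tq_one Tq_mul.
Proof. by move=> x; rewrite -[x]reprK -pi_TqM mulr1. Qed.

Let mulDl : left_distributive Tq_mul +%R.
Proof.
move=> x y z; rewrite -[x]reprK -[y]reprK -[z]reprK.
by rewrite -!(pi_TqM, pi_TqD) mulrDl.
Qed.

Let mulDr : right_distributive Tq_mul +%R.
Proof.
move=> x y z; rewrite -[x]reprK -[y]reprK -[z]reprK.
by rewrite -!(pi_TqM, pi_TqD) mulrDr.
Qed.

Let one_neq0 : Tq_one != 0.
Proof.
have pi0 : 0 = \pi_Tq (0 : F) :> Tq.
  by apply: (addrI (\pi_Tq (0 : F))); rewrite -pi_TqD !addr0.
apply/eqP; rewrite pi0 => /pi_Tq_eq; rewrite subr0 => /asboolP.
pose ev (x : F) : K := mcoeff (mone : {fmonom _}) (x : M).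
have evM x y : ev (x * y) = ev x * ev y by exact: rmorphM.
have evB x y : ev (x - y) = ev x - ev y by exact: mcoeffB.
have evZ c x : ev (c *: x) = c * ev x by exact: mcoeffZ.
have ev0i i : ev (gX i) = 0 by rewrite [LHS]mcoeffU1 -val_eqE /= fmU fm1.
have ev0 : ev 0 = 0 by exact: mcoeff0.
have ev1 : ev 1 = 1 by exact: rmorph1.
clearbody ev => /(_ [set x : F | ev x = 0]) H.
have: ev 1 = 0; last by move/eqP; rewrite ev1 oner_eq0.
apply: H; split; first split=> //=.
- by move=> x y x0 y0; rewrite evB x0 y0 subrr.
- by move=> a x x0; rewrite evM x0 mulr0.
- by move=> a x x0; rewrite evM x0 mul0r.
have evXX i j : ev (gX i * gX j) = 0 by rewrite evM ev0i mul0r.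
have evZXX c i j : ev (c *: (gX i * gX j)) = 0 by rewrite evZ evXX mulr0.
have ev_eq0 x y : ev x = 0 -> ev y = 0 -> ev (x - y) = 0.
  by move=> x0 y0; rewrite evB x0 y0 subrr.
move=> x [[->|->]|->].
- exact: (ev_eq0 _ _ (evXX _ _) (evZXX _ _ _)).
- exact: (ev_eq0 _ _ (evXX _ _) (evZXX _ _ _)).
- exact: (ev_eq0 _ _ (evXX _ _) (evXX _ _)).
Qed.

HB.instance Definition _ := GRing.Zmodule_isNzRing.Build Tq
  mulA mul1 mulx1 mulDl mulDr one_neq0.

Lemma Tq_piM (x y : F) : \pi_Tq (x * y) = \pi_Tq x * \pi_Tq y :> Tq.
Proof. exact: pi_TqM. Qed.

Lemma Tq_pi1 : \pi_Tq (1 : F) = 1 :> Tq.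
Proof. by []. Qed.

Let scaleAl (c : K) (x y : Tq) : c *: (x * y) = c *: x * y.
Proof.
rewrite -[x]reprK -[y]reprK -Tq_piM.
have piZ (f : F) : c *: (\pi_Tq f : Tq) = \pi_Tq (c *: f).
  by rewrite [RHS]pi_quotmodZ.
by rewrite !piZ -Tq_piM scalerAl.
Qed.

HB.instance Definition _ := GRing.Lmodule_isLalgebra.Build K Tq scaleAl.

Let scaleAr (c : K) (x y : Tq) : c *: (x * y) = x * (c *: y).
Proof.
rewrite -[x]reprK -[y]reprK -Tq_piM.
have piZ (f : F) : c *: (\pi_Tq f : Tq) = \pi_Tq (c *: f).
  by rewrite [RHS]pi_quotmodZ.
by rewrite !piZ -Tq_piM scalerAr.
Qed.

HB.instance Definition _ := GRing.Lalgebra_isAlgebra.Build K Tq scaleAr.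

End Tq.

HB.lock Definition Tq_gen (K : fieldType) (q : K) (i : 'I_3) : Tq q :=
  \pi_(Tq q) (freeVar K i).

Section TqTheory.
Variables (K : fieldType) (q : K).

Local Notation F := (freeAlg K 'I_3).
Local Notation M := {malg K[{fmonom 'I_3}]}.
Local Notation gX i := (freeVar K i : F).
Local Notation T := (Tq q).
Local Notation a i := (Tq_gen q i).

Lemma Tq_piZ c (x : F) : c *: (\pi_T x : T) = \pi_T (c *: x).
Proof. by rewrite [RHS]pi_quotmodZ. Qed.

Lemma Tq_piD (x y : F) : \pi_T (x + y) = \pi_T x + \pi_T y :> T.
Proof. exact: pi_quotmodD. Qed.

Lemma Tq_relP (x y : F) : Tq_relators q (x - y) -> \pi_T x = \pi_T y :> T.
Proof. by move=> xy; apply/pi_Tq_eq/asboolP; apply: sub_gen_smallest. Qed.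

Lemma Tq_rel2212 : a i22 * a i12 = q *: (a i12 * a i22).
Proof.
by rewrite Tq_gen.unlock -!Tq_piM Tq_piZ; apply: Tq_relP; left; left.
Qed.

Lemma Tq_rel1112 : a i11 * a i12 = q *: (a i12 * a i11).
Proof.
by rewrite Tq_gen.unlock -!Tq_piM Tq_piZ; apply: Tq_relP; left; right.
Qed.

Lemma Tq_rel1122 : a i11 * a i22 = a i22 * a i11.
Proof. by rewrite Tq_gen.unlock -!Tq_piM; apply: Tq_relP; right. Qed.

Lemma Tq_ind (P : T -> Prop) :
  P 1 -> (forall i x, P x -> P (a i * x)) ->
  (forall c x y, P x -> P y -> P (c *: x + y)) -> forall x, P x.
Proof.
move=> P1 PM PL x.
have P0 : P 0 by rewrite -(addNr 1) -scaleN1r; apply: PL.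
have PZ c y : P y -> P (c *: y) by rewrite -[_ *: _]addr0 => Py; apply: PL.
have Pword (m : {fmonom 'I_3}) : P (\pi_T (<< m >> : F)).
  case: m; elim=> [|i m IHm].
    by rewrite -fmoneE [\pi_T _]/(1 : T).
  suff -> : << FMonom (i :: m) >> = gX i * << FMonom m >> :> F.
    by have := PM i _ IHm; rewrite Tq_gen.unlock Tq_piM.
  have -> : FMonom (i :: m) = mmul (fmu i) (FMonom m).
    by apply/eqP; rewrite fmP fmM fmU.
  by rewrite [RHS](fgmulUU (1 : K) 1 (fmu i) (FMonom m)) mul1r.
rewrite -[x]reprK; move: (repr x) => {x} f.
have -> : f = \sum_(k <- finmap.enum_fset (msupp (f : M)))
    mcoeff k (f : M) *: (<< k >> : F).
  rewrite {1}[f]monalgE; apply: eq_bigr => k _.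
  have ZU (c : K) (l : {fmonom 'I_3}) :
      c *: << l >> = << c *g l >> :> M.
    by rewrite -mul_malgC [LHS]fgmulUU mul1m mulr1.
  by rewrite -[RHS]/(_ *: << k >> : M) ZU.
elim: (finmap.enum_fset _) => [|k s IHs].
  rewrite big_nil; suff -> : \pi_T (0 : F) = 0 by [].
  by apply: (addrI (\pi_T (0 : F))); rewrite -Tq_piD !addr0.
by rewrite big_cons Tq_piD -Tq_piZ; apply: PL.
Qed.

(* The universal property of the presentation. *)
Section Lift.
Variables (S : nzRingType) (phi : {rmorphism K -> S}) (s : 'I_3 -> S).
Hypothesis phiC : forall c x, phi c * x = x * phi c.
Hypothesis rel2212 : s i22 * s i12 = phi q * (s i12 * s i22).
Hypothesis rel1112 : s i11 * s i12 = phi q * (s i12 * s i11).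
Hypothesis rel1122 : s i11 * s i22 = s i22 * s i11.

Let word (m : {fmonom 'I_3}) : S := \prod_(i <- (m : seq 'I_3)) s i.

Let word_mmorphism : mmorphism word.
Proof.
by split=> [m n|]; rewrite /word ?fmM ?big_cat // fm1 big_nil.
Qed.

HB.instance Definition _ :=
  monalg.isMultiplicative.Build {fmonom 'I_3} S word word_mmorphism.

Let lift (f : F) : S := mmap phi word (f : M).

Let liftB x y : lift (x - y) = lift x - lift y.
Proof. exact: mmapB. Qed.

Let liftM x y : lift (x * y) = lift x * lift y.
Proof.
have [H _] := @commr_mmap_is_multiplicative _ K S phi word
  (fun _ _ _ => phiC _ _).
exact: H.
Qed.

Let lift1 : lift 1 = 1.
Proof. exact: mmap1. Qed.

Let liftZ c x : lift (c *: x) = phi c * lift x.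
Proof. exact: mmapZ. Qed.

Let liftX i : lift (gX i) = s i.
Proof.
transitivity (phi 1 * word (fmu i)); first exact: mmapU.
rewrite rmorph1 mul1r /word fmU.
by rewrite big_cons big_nil mulr1.
Qed.

Let lift_ideal x : x \in Tq_ideal q -> lift x = 0.
Proof.
have lB y z : lift y = 0 -> lift z = 0 -> lift (y - z) = 0.
  by move=> y0 z0; rewrite liftB y0 z0 subrr.
have lX0 y z : lift y = lift z -> lift (y - z) = 0.
  by move=> yz; rewrite liftB yz subrr.
have lXX i j : lift (gX i * gX j) = s i * s j by rewrite liftM !liftX.
have lZXX c i j : lift (c *: (gX i * gX j)) = phi c * (s i * s j).
  by rewrite liftZ lXX.
move=> /asboolP; apply: (@smallest_sub _ _ _ [set y | lift y = 0]).
  split=> //=.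
  - by have := lX0 0 0 erefl; rewrite subrr.
  - by move=> b y y0; rewrite liftM y0 mulr0.
  - by move=> b y y0; rewrite liftM y0 mul0r.
move=> y [[->|->]|->]; apply: lX0.
- by apply: etrans (lXX _ _) _; rewrite rel2212; apply/esym/lZXX.
- by apply: etrans (lXX _ _) _; rewrite rel1112; apply/esym/lZXX.
- by apply: etrans (lXX _ _) _; rewrite rel1122; apply/esym/lXX.
Qed.

Let lift_pi x y : \pi_T x = \pi_T y :> T -> lift x = lift y.
Proof.
by move/pi_Tq_eq/lift_ideal; rewrite liftB => /eqP; rewrite subr_eq0 => /eqP.
Qed.

Lemma Tq_lift : exists f : T -> S,
  [/\ forall x y, f (x - y) = f x - f y, f 1 = 1,
      forall x y, f (x * y) = f x * f y,
      forall c x, f (c *: x) = phi c * f x & forall i, f (a i) = s i].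
Proof.
pose f (x : T) := lift (repr x).
have fpi x : f (\pi_T x) = lift x by apply: lift_pi; rewrite reprK.
have piB (x y : F) : \pi_T x - \pi_T y = \pi_T (x - y) :> T.
  by rewrite -[- \pi_T y]scaleN1r Tq_piZ -Tq_piD scaleN1r.
exists f; split=> [x y||x y|c x|i].
- by rewrite -[x]reprK -[y]reprK piB !fpi liftB.
- by rewrite -[1]/(\pi_T (1 : F)) fpi lift1.
- by rewrite -[x]reprK -[y]reprK -Tq_piM !fpi liftM.
- by rewrite -[x]reprK Tq_piZ !fpi liftZ.
- by rewrite Tq_gen.unlock fpi liftX.
Qed.

End Lift.

End TqTheory.

Section TqDerivations.
Variables (K : fieldType) (q : K).

Local Notation T := (Tq q).
Local Notation a i := (Tq_gen q i).

Lemma Der_linear (D : Der T) : linear (val D).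
Proof. by case/asboolP: (valP D). Qed.

Lemma Der_mul (D : Der T) x y : val D (x * y) = val D x * y + x * val D y.
Proof. by case/asboolP: (valP D) => _; apply. Qed.

Lemma Tq_Der_unique (D E : Der T) :
  (forall i, val D (a i) = val E (a i)) -> D = E.
Proof.
have Der1 (G : Der T) : val G 1 = 0.
  have /esym/eqP := Der_mul G 1 1.
  by rewrite !mulr1 mul1r -subr_eq0 addrK => /eqP.
move=> DE; apply/val_inj/funext; apply: Tq_ind => [|i x DEx|c x y DEx DEy].
- by rewrite !Der1.
- by rewrite !Der_mul DE DEx.
- by rewrite !Der_linear DEx DEy.
Qed.

Lemma Tq_Der_exists (d : 'I_3 -> T) :
  d i22 * a i12 + a i22 * d i12 = q *: (d i12 * a i22 + a i12 * d i22) ->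
  d i11 * a i12 + a i11 * d i12 = q *: (d i12 * a i11 + a i12 * d i11) ->
  d i11 * a i22 + a i11 * d i22 = d i22 * a i11 + a i22 * d i11 ->
  exists D : Der T, forall i, val D (a i) = d i.
Proof.
move=> d2212 d1112 d1122.
pose phi : {rmorphism K -> 'M[T]_2} := @scalar_mx T 2 \o in_alg T.
have phiE c (A : 'M[T]_2) : phi c * A = c *: (1 : T) *: A.
  exact: mul_scalar_mx.
have phiC c A : phi c * A = A * phi c.
  apply/matrixP => i j; rewrite phiE !mxE (bigD1 j) //= big1 => [|k kj].
    by rewrite !mxE eqxx mulr1n addr0 -scalerAl mul1r -scalerAr mulr1.
  by rewrite !mxE (negPf kj) mulr0n mulr0.
(* x |-> the upper triangular matrix with diagonal x, x and corner y *)
pose tr (x y : T) : 'M[T]_2 :=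
  \matrix_(i, j) if i == j then x else if i == 0 then y else 0.
have trM x y z t : tr x y * tr z t = tr (x * z) (x * t + y * z).
  apply/matrixP => i j; rewrite !mxE !big_ord_recl big_ord0 !mxE addr0.
  by case: i j => [[|[|]]] // ? [[|[|]]] // ?;
    rewrite /= ?mul0r ?mulr0 ?addr0 ?add0r.
have trZ c x y : phi c * tr x y = tr (c *: x) (c *: y).
  rewrite phiE; apply/matrixP => i j; rewrite !mxE.
  by case: eqP => _; last case: eqP => _; rewrite ?mulr0 // -scalerAl mul1r.
have trD x y z t : tr x y + tr z t = tr (x + z) (y + t).
  apply/matrixP => i j; rewrite !mxE.
  by case: eqP => // _; case: eqP; rewrite ?addr0.
have [] := @Tq_lift K q 'M[T]_2 phi (fun i => tr (a i) (d i)) phiC.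
- by rewrite !trM trZ Tq_rel2212 addrC d2212 addrC.
- by rewrite !trM trZ Tq_rel1112 addrC d1112 addrC.
- by rewrite !trM Tq_rel1122 addrC d1122 addrC.
move=> f [fB f1 fM fZ fa].
have fD x y : f (x + y) = f x + f y.
  have f0 : f 0 = 0 by rewrite -(subrr 0) fB subrr.
  by rewrite -[y in LHS]opprK fB -[- y]add0r fB f0 sub0r opprK.
have fE x : f x = tr x (f x 0 1).
  elim/(@Tq_ind K q): x => [|i x IHx|c x y IHx IHy].
  - by rewrite f1; apply/matrixP => -[[|[|]]] // ? [[|[|]]] // ?; rewrite !mxE.
  - by rewrite fM fa IHx trM; congr tr; rewrite mxE.
  - by rewrite fD fZ IHx IHy trZ trD; congr tr; rewrite mxE.
have fder : (fun x => f x 0 1) \in @derivation K T.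
  apply/asboolP; split=> [c x y|x y].
    by rewrite fD fZ (fE x) (fE y) trZ trD !mxE.
  by rewrite fM (fE x) (fE y) trM !mxE /= addrC.
by exists (@Sub _ _ (Der T) (fun x => f x 0 1) fder) => i; rewrite SubK fa mxE.
Qed.

Definition Tq_mon (n11 n12 n22 : nat) : T :=
  a i11 ^+ n11 * a i12 ^+ n12 * a i22 ^+ n22.

Definition is_Dmon (st : 'I_3) (n11 n12 n22 : nat) (D : Der T) : Prop :=
  val D (a st) = Tq_mon n11 n12 n22 /\
  forall i, i != st -> val D (a i) = 0.

(* Equal to 0 when no such derivation exists; when one exists it is unique, see
   Dmon_unique. Existence in the cases used is shown by D11P, D12P, D22P,
   D11_001P and D22_100P. *)
Definition Dmon (st : 'I_3) (n11 n12 n22 : nat) : Der T :=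
  xget 0 [set D | is_Dmon st n11 n12 n22 D].

Definition D11 : Der T := Dmon i11 1 0 0.
Definition D12 : Der T := Dmon i12 0 1 0.
Definition D22 : Der T := Dmon i22 0 0 1.

Lemma Dmon_unique st n11 n12 n22 (D : Der T) :
  is_Dmon st n11 n12 n22 D -> Dmon st n11 n12 n22 = D.
Proof.
move=> DP; apply: xget_unique => // E [Est E0]; case: DP => Dst D0.
apply: Tq_Der_unique => i; have [->|ist] := eqVneq i st.
  by rewrite Dst Est.
by rewrite D0 // E0.
Qed.

Lemma DmonP st n11 n12 n22 (m := Tq_mon n11 n12 n22)
    (d := fun i => if i == st then m else 0 : T) :
  d i22 * a i12 + a i22 * d i12 = q *: (d i12 * a i22 + a i12 * d i22) ->
  d i11 * a i12 + a i11 * d i12 = q *: (d i12 * a i11 + a i12 * d i11) ->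
  d i11 * a i22 + a i11 * d i22 = d i22 * a i11 + a i22 * d i11 ->
  is_Dmon st n11 n12 n22 (Dmon st n11 n12 n22).
Proof.
move=> d1 d2 d3; apply: (@xgetPex _ 0 [set D | is_Dmon st n11 n12 n22 D]).
have [D DE] := Tq_Der_exists d1 d2 d3.
by exists D; split=> [|i /negPf ist]; rewrite DE /d ?eqxx ?ist.
Qed.

Let ne : ((i11 == i12 = false) * (i11 == i22 = false) * (i12 == i22 = false) *
  (i12 == i11 = false) * (i22 == i11 = false) * (i22 == i12 = false))%type.
Proof. by []. Qed.

Let simp := (ne, eqxx, mul0r, mulr0, addr0, add0r, expr0, expr1, mul1r, mulr1).

Lemma D11P : is_Dmon i11 1 0 0 D11.
Proof.
by apply: DmonP; rewrite /Tq_mon !simp ?scaler0 // (Tq_rel1112, Tq_rel1122).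
Qed.

Lemma D12P : is_Dmon i12 0 1 0 D12.
Proof.
by apply: DmonP; rewrite /Tq_mon !simp ?scaler0 // (Tq_rel1112, Tq_rel2212).
Qed.

Lemma D22P : is_Dmon i22 0 0 1 D22.
Proof.
by apply: DmonP; rewrite /Tq_mon !simp ?scaler0 // (Tq_rel1122, Tq_rel2212).
Qed.

Lemma D11_001P : is_Dmon i11 0 0 1 (Dmon i11 0 0 1).
Proof. by apply: DmonP; rewrite /Tq_mon !simp ?scaler0 // Tq_rel2212. Qed.

Lemma D22_100P : is_Dmon i22 1 0 0 (Dmon i22 1 0 0).
Proof. by apply: DmonP; rewrite /Tq_mon !simp ?scaler0 // Tq_rel1112. Qed.

End TqDerivations.

(* Main.v *)
(* T_q(2) has the basis a_12^j a_11^i a_22^k, and the relations split the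
   coordinates of a derivation D according to the bidegree (j, n) by which D
   shifts the degrees in a_12 and in {a_11, a_22}. If j > 0 or n > 0, that part
   of D is the commutator with an element whose coefficients are those of
   D(a_11) divided by 1 - q^j, respectively those of D(a_12) divided by q^n - 1;
   the divisors do not vanish as q is not a root of unity. The parts with
   j < 0 or n < 0 vanish. In bidegree (0, 0) every linear map of
   <a_11, a_22> to itself and every scaling of a_12 is allowed, which gives
   dimension 5, and the inner derivations have no part there. *)
Require Import Defs.
From HB Require Import structures.
From mathcomp Require Import all_boot all_order all_algebra.
From mathcomp Require Import boolp classical_sets functions.
From mathcomp Require Import generic_quotient ring.

Set Implicit Arguments.
Unset Strict Implicit.
Unset Printing Implicit Defensive.

Import GRing.Theory.
Local Open Scope ring_scope.
Local Open Scope quotient_scope.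
Local Open Scope classical_set_scope.

(** * The endomorphisms of a vector space as a [K]-algebra *)

Section Endomorphisms.
Variables (K : fieldType) (V : lmodType K).

Definition is_endo : {pred V -> V} := fun f => `[< linear f >].

Lemma endo_submod_closed : submod_closed is_endo.
Proof.
split=> [|c f g /asboolP fl /asboolP gl]; apply/asboolP.
  by move=> c x y /=; rewrite scaler0 addr0.
move=> b x y; rewrite !addrfctE !scalrfctE fl gl !scalerDr !scalerA.
by rewrite [c * b]mulrC addrACA.
Qed.

HB.instance Definition _ := GRing.isSubmodClosed.Build K (V -> V)
  is_endo endo_submod_closed.

Variables (v : V) (v_neq0 : v != 0).

(* The nonzero vector only serves to make the ring nontrivial, as Tq_lift
   requires. *)
Definition endo of v != 0 : Type := {f : V -> V | f \in is_endo}.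

Local Notation E := (endo v_neq0).

HB.instance Definition _ := [isSub of E for @sval _ _].
HB.instance Definition _ := [Choice of E by <:].
HB.instance Definition _ := [SubChoice_isSubLmodule of E by <:].

Lemma endo_linear (f : E) : linear (val f).
Proof. by apply/asboolP/(valP f). Qed.

Lemma endoZ (f : E) c x : val f (c *: x) = c *: val f x.
Proof.
have f0 : val f 0 = 0.
  by have /esym := endo_linear f (-1) 0 0; rewrite !scaleN1r !addNr.
by have := endo_linear f c x 0; rewrite f0 !addr0.
Qed.

Definition endo_of (f : V -> V) (fl : linear f) : E := Sub f (asboolT fl).

Definition endo_one : E := @endo_of id (fun c x y => erefl).

Lemma endo_comp_linear (f g : E) : linear (val f \o val g).
Proof. by move=> c x y /=; rewrite !endo_linear. Qed.

Definition endo_mul (f g : E) : E := endo_of (endo_comp_linear f g).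

Let mulA : associative endo_mul. Proof. by move=> f g h; apply: val_inj. Qed.

Let mul1f : left_id endo_one endo_mul.
Proof. by move=> f; apply: val_inj. Qed.

Let mulf1 : right_id endo_one endo_mul.
Proof. by move=> f; apply: val_inj. Qed.

Let mulDl : left_distributive endo_mul +%R.
Proof. by move=> f g h; apply: val_inj. Qed.

Let mulDr : right_distributive endo_mul +%R.
Proof.
move=> f g h; apply/val_inj/funext => x /=.
by have := endo_linear f 1 (val g x) (val h x); rewrite !scale1r.
Qed.

Let one_neq0 : endo_one != 0.
Proof.
by apply/eqP => /(congr1 (fun f : E => val f v)) v0; case/eqP: v_neq0.
Qed.

HB.instance Definition _ :=
  GRing.Zmodule_isNzRing.Build E mulA mul1f mulf1 mulDl mulDr one_neq0.

Let scaleAl (c : K) (f g : E) : c *: (f * g) = c *: f * g.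
Proof. by apply: val_inj. Qed.

HB.instance Definition _ := GRing.Lmodule_isLalgebra.Build K E scaleAl.

Let scaleAr (c : K) (f g : E) : c *: (f * g) = f * (c *: g).
Proof. by apply/val_inj/funext => x; apply/esym/endoZ. Qed.

HB.instance Definition _ := GRing.Lalgebra_isAlgebra.Build K E scaleAr.

End Endomorphisms.

(** The universal property, applied to the endomorphism algebra of [V], turns [V] into a left module
    over [Tq q]; [c] is the orbit map of [v]. *)
Lemma Tq_module_map (K : fieldType) (q : K) (V : lmodType K) (v : V)
    (A : 'I_3 -> V -> V) :
  v != 0 -> (forall i, linear (A i)) ->
  (forall u, A i22 (A i12 u) = q *: A i12 (A i22 u)) ->
  (forall u, A i11 (A i12 u) = q *: A i12 (A i11 u)) ->
  (forall u, A i11 (A i22 u) = A i22 (A i11 u)) ->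
  exists c : Tq q -> V,
    [/\ linear c, c 1 = v & forall i t, c (Tq_gen q i * t) = A i (c t)].
Proof.
move=> v_neq0 Al r2212 r1112 r1122.
have [] := @Tq_lift K q (endo v_neq0) (in_alg (endo v_neq0))
  (fun i => endo_of v_neq0 (Al i)).
- by move=> k x; rewrite /= -scalerAl mul1r -scalerAr mulr1.
- by rewrite -scalerAl mul1r; apply/val_inj/funext => u; apply: r2212.
- by rewrite -scalerAl mul1r; apply/val_inj/funext => u; apply: r1112.
- by apply/val_inj/funext => u; apply: r1122.
move=> f [fB f1 fM fZ fa]; exists (fun t => val (f t) v); split.
- move=> k t u.
  have -> : f (k *: t + u) = k *: f t + f u.
    by rewrite -[u in LHS]opprK fB -[- u]add0r fB -(subrr 1) fB subrr sub0r
      opprK fZ -scalerAl mul1r.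
  by [].
- by rewrite f1.
- by move=> i t; rewrite fM fa.
Qed.

Lemma gen_cases (s : 'I_3) : [\/ s = i11, s = i12 | s = i22].
Proof.
by case: s => [[|[|[|]]] // s3]; [constructor 1|constructor 2|constructor 3];
  apply: val_inj.
Qed.

(** * Coordinates on the basis of ordered monomials *)

Section Coordinates.
Variables (K : fieldType) (q : K).

Local Notation T := (Tq q).
Local Notation a i := (Tq_gen q i).
Local Notation coefs := (nat * nat * nat -> K^o).

(* A triple (j, i, k) stands for the ordered monomial
   a_12^j a_11^i a_22^k, for which no power of q^-1 is needed below. *)
Definition Tq_omon (m : nat * nat * nat) : T :=
  a i12 ^+ m.1.1 * a i11 ^+ m.1.2 * a i22 ^+ m.2.

(** The powers of [q] come from restoring the order: on the left, [a i11] and [a i22] pass [a_12^j];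
    in [rmul_gen], [a i12] passes [a_11^i a_22^k] from the right. *)
Definition lmul_gen (s : 'I_3) (F : coefs) : coefs := fun m =>
  let: (j, i, k) := m in
  match val s with
  | 0%N => if i is i'.+1 then q ^+ j * F (j, i', k) else 0
  | 1%N => if j is j'.+1 then F (j', i, k) else 0
  | _ => if k is k'.+1 then q ^+ j * F (j, i, k') else 0
  end.

Definition rmul_gen (s : 'I_3) (F : coefs) : coefs := fun m =>
  let: (j, i, k) := m in
  match val s with
  | 0%N => if i is i'.+1 then F (j, i', k) else 0
  | 1%N => if j is j'.+1 then q ^+ (i + k) * F (j', i, k) else 0
  | _ => if k is k'.+1 then F (j, i, k') else 0
  end.

Definition coefs_delta (m : nat * nat * nat) : coefs := fun n => (n == m)%:R.

Lemma coefsP (c : K) (F G : coefs) m : (c *: F + G) m = c * F m + G m.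
Proof. by []. Qed.

Lemma lmul_gen_linear s : linear (lmul_gen s).
Proof.
move=> c F G; apply/funext => -[[j i] k]; rewrite coefsP /lmul_gen.
by case: s => [[|[|s]] _] /=; case: i j k => [|i] [|j] [|k];
  rewrite ?coefsP ?mulr0 ?addr0 // mulrDr mulrCA.
Qed.

Lemma rmul_gen_linear s : linear (rmul_gen s).
Proof.
move=> c F G; apply/funext => -[[j i] k]; rewrite coefsP /rmul_gen.
by case: s => [[|[|s]] _] /=; case: i j k => [|i] [|j] [|k];
  rewrite ?coefsP ?mulr0 ?addr0 // mulrDr mulrCA.
Qed.

(** Associativity in coordinates. Powers of [q] have to be compared only for [a i11] or [a i22] on
    the left and [a i12] on the right; both orders then give the exponent [j + i + k - 1]. *)
Lemma lmul_rmul_gen s t F :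
  lmul_gen s (rmul_gen t F) = rmul_gen t (lmul_gen s F).
Proof.
have qC m n x : q ^+ m.+1 * (q ^+ n * x) = q ^+ n.+1 * (q ^+ m * x).
  by rewrite !exprS -!mulrA; congr (_ * _); rewrite mulrCA.
apply/funext => -[[j i] k]; rewrite /lmul_gen /rmul_gen.
case: s t => [[|[|s]] _] [[|[|t]] _] /=.
all: case: i j k => [|[|i]] [|[|j]] [|[|k]].
all: rewrite ?(add0n, addn0, addnS, addSn) ?mulr0 //.
all: exact: qC.
Qed.

(** All coefficient functions, whatever their support, form a left module through [lmul_gen]; the
    map is the orbit of the coordinates of [1]. *)
Lemma Tq_coord_exists : exists c : T -> coefs,
  [/\ linear c, c 1 = coefs_delta (0, 0, 0)%N
    & forall i t, c (a i * t) = lmul_gen i (c t)].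
Proof.
apply: Tq_module_map.
- apply/eqP => /(congr1 (fun F : coefs => F (0, 0, 0)%N)).
  by move/eqP; rewrite /coefs_delta eqxx oner_eq0.
- exact: lmul_gen_linear.
- by move=> u; apply/funext => -[[[|j] i] [|k]];
    rewrite -[RHS]/(_ * _) /lmul_gen /= ?mulr0 // exprS -mulrA.
- by move=> u; apply/funext => -[[[|j] [|i]] k];
    rewrite -[RHS]/(_ * _) /lmul_gen /= ?mulr0 // exprS -mulrA.
- by move=> u; apply/funext => -[[j [|i]] [|k]]; rewrite /lmul_gen /= ?mulr0.
Qed.

Definition Tq_coord : T -> coefs := projT1 (cid Tq_coord_exists).

Lemma Tq_coord_linear : linear Tq_coord.
Proof. by rewrite /Tq_coord; case: cid => c []. Qed.

HB.instance Definition _ :=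
  GRing.isLinear.Build K T coefs *:%R Tq_coord Tq_coord_linear.

Lemma Tq_coord1 : Tq_coord 1 = coefs_delta (0, 0, 0)%N.
Proof. by rewrite /Tq_coord; case: cid => c []. Qed.

Lemma Tq_coord_lmul i t : Tq_coord (a i * t) = lmul_gen i (Tq_coord t).
Proof. by rewrite /Tq_coord; case: cid => c []. Qed.

(** [Tq_coord] is built from left multiplications alone; [lmul_rmul_gen] carries the right factor
    past them, down to the case of [1]. *)
Lemma Tq_coord_rmul i t : Tq_coord (t * a i) = rmul_gen i (Tq_coord t).
Proof.
elim/(@Tq_ind K q): t => [|s t IHt|c t u IHt IHu].
- rewrite mul1r -[a i]mulr1 Tq_coord_lmul Tq_coord1.
  apply/funext => -[[j l] k]; rewrite /lmul_gen /rmul_gen /coefs_delta.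
  case: i => [[|[|i]] _] /=; case: j l k => [|j] [|l] [|k];
    rewrite ?xpair_eqE /= ?andbF ?expr0 ?mul1r ?mulr0 //.
- by rewrite -mulrA !Tq_coord_lmul IHt lmul_rmul_gen.
- by rewrite mulrDl -scalerAl !Tq_coord_linear IHt IHu rmul_gen_linear.
Qed.

(** This yields the linear independence of the ordered monomials. Stripping [a_22] and [a_11] from
    the right and [a_12] from the left produces no power of [q]. *)
Lemma Tq_coord_omon m : Tq_coord (Tq_omon m) = coefs_delta m.
Proof.
case: m => [[j i] k]; rewrite /Tq_omon /=.
elim: k => [|k IHk]; last first.
  rewrite exprSr mulrA Tq_coord_rmul IHk; apply/funext => -[[j' i'] [|k']].
    by rewrite /coefs_delta !xpair_eqE andbF.
  by rewrite /rmul_gen /coefs_delta /= !xpair_eqE eqSS.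
rewrite expr0 mulr1; elim: i => [|i IHi]; last first.
  rewrite exprSr mulrA Tq_coord_rmul IHi; apply/funext => -[[j' [|i']] k'].
    by rewrite /coefs_delta !xpair_eqE andbF.
  by rewrite /rmul_gen /coefs_delta /= !xpair_eqE eqSS.
rewrite expr0 mulr1; elim: j => [|j IHj]; first by rewrite Tq_coord1.
rewrite exprS Tq_coord_lmul IHj; apply/funext => -[[[|j'] i'] k'].
  by rewrite /coefs_delta !xpair_eqE.
by rewrite /lmul_gen /coefs_delta /= !xpair_eqE eqSS.
Qed.

Lemma Tq_span (P : T -> Prop) :
  (forall m, P (Tq_omon m)) ->
  (forall c t u, P t -> P u -> P (c *: t + u)) -> forall t, P t.
Proof.
move=> Pm PL t; move: t P Pm PL.
apply: (@Tq_ind K q) => [|s t IHt|c t u IHt IHu] P Pm PL.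
- by have := Pm (0, 0, 0)%N; rewrite /Tq_omon !expr0 !mulr1.
- apply: (IHt (fun u => P (a s * u))) => [m|c u w]; last first.
    by rewrite mulrDr -scalerAr; apply: PL.
  have P0 : P 0 by rewrite -(addNr (Tq_omon m)) -scaleN1r; apply: PL.
  have PZ c n : P (c *: Tq_omon n) by rewrite -[_ *: _]addr0; apply: PL.
  case: m => [[j i] k]; rewrite /Tq_omon /=.
  have comm (u w : T) : u * w = q *: (w * u) ->
      forall n, u * w ^+ n = q ^+ n *: (w ^+ n * u).
    move=> uw; elim=> [|n IHn]; first by rewrite expr0 mulr1 mul1r scale1r.
    rewrite [in LHS]exprSr mulrA IHn -scalerAl -(mulrA _ u w) uw -scalerAr.
    by rewrite scalerA mulrA -!exprSr.
  have [sE|sE|sE] := gen_cases s.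
  + rewrite sE !mulrA (comm (a i11) (a i12)) ?Tq_rel1112 // -!scalerAl.
    by rewrite -(mulrA _ _ (_ ^+ i)) -exprS; apply: (PZ _ (j, i.+1, k)).
  + by have := PZ 1 (j.+1, i, k); rewrite scale1r /Tq_omon /= exprS sE !mulrA.
  + rewrite sE !mulrA (comm (a i22) (a i12)) ?Tq_rel2212 // -!scalerAl.
    rewrite -(mulrA _ _ (_ ^+ i)) (commrX i (esym (Tq_rel1122 q))) mulrA.
    by rewrite -(mulrA _ _ (_ ^+ k)) -exprS; apply: (PZ _ (j, i, k.+1)).
- exact: (PL c t u (IHt P Pm PL) (IHu P Pm PL)).
Qed.

(** Allowing every larger list [r'] lets two elements be expanded over a common list, both for sums
    and for injectivity of [Tq_coord]. *)
Lemma Tq_expand t : exists r : seq (nat * nat * nat),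
  forall r', uniq r' -> {subset r <= r'} ->
    t = \sum_(m <- r') Tq_coord t m *: Tq_omon m.
Proof.
elim/Tq_span: t => [m|c t u [r tr] [r' ur']].
  exists [:: m] => r r_uniq mr; have {}mr : m \in r by apply: mr; rewrite inE.
  rewrite (bigD1_seq m) //= big1 => [|n nm]; rewrite Tq_coord_omon /coefs_delta.
    by rewrite eqxx scale1r addr0.
  by rewrite (negPf nm) scale0r.
exists (r ++ r') => s s_uniq rs.
rewrite {1}(tr s) // => [|m mr]; last by rewrite rs // mem_cat mr.
rewrite {1}(ur' s) // => [|m mr]; last by rewrite rs // mem_cat mr orbT.
rewrite scaler_sumr -big_split /=; apply: eq_bigr => m _.
by rewrite linearP /= scalerA -scalerDl.
Qed.

Lemma Tq_coord_inj : injective Tq_coord.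
Proof.
move=> t u tu; have [[r tr] [r' ur']] := (Tq_expand t, Tq_expand u).
have [] : {subset r <= undup (r ++ r')} /\ {subset r' <= undup (r ++ r')}.
  by split=> m mr; rewrite mem_undup mem_cat mr ?orbT.
move=> /(tr _ (undup_uniq _)) tE /(ur' _ (undup_uniq _)) uE.
by apply: etrans tE _; rewrite tu -uE.
Qed.

Lemma Tq_coord_sum (r : seq (nat * nat * nat)) (w : coefs) :
  Tq_coord (\sum_(m <- r) w m *: Tq_omon m) =
  \sum_(m <- r) w m *: coefs_delta m.
Proof.
rewrite linear_sum; apply: eq_bigr => m _.
by rewrite linearZ /= Tq_coord_omon.
Qed.

Lemma coefs_sum_delta (r : seq (nat * nat * nat)) (w : coefs) n : uniq r ->
  (\sum_(m <- r) w m *: coefs_delta m) n = if n \in r then w n else 0.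
Proof.
elim: r => [|m r IHr] /=; first by rewrite big_nil.
move=> /andP[mr r_uniq]; rewrite big_cons coefsP IHr // inE /coefs_delta.
have [->|nm] := eqVneq n m; first by rewrite (negPf mr) addr0 mulr1.
by rewrite mulr0 add0r.
Qed.

Lemma Tq_coord_fin t : exists r : seq (nat * nat * nat),
  forall m, m \notin r -> Tq_coord t m = 0.
Proof.
have [r tr] := Tq_expand t; exists (undup r) => m mr.
rewrite (tr (undup r)) ?undup_uniq // => [|n]; last by rewrite mem_undup.
by rewrite Tq_coord_sum coefs_sum_delta ?undup_uniq // (negPf mr).
Qed.

Lemma Tq_coord_surj (w : coefs) (r : seq (nat * nat * nat)) :
  (forall m, m \notin r -> w m = 0) -> exists t, Tq_coord t = w.
Proof.
move=> w0; exists (\sum_(m <- undup r) w m *: Tq_omon m).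
apply/funext => m; rewrite Tq_coord_sum coefs_sum_delta ?undup_uniq //.
by rewrite mem_undup; case: ifPn => // /w0.
Qed.

End Coordinates.

(** * A complement spanned by a dual family *)

Section Complement.
Variables (K : fieldType) (V : lmodType K) (W : submodClosed V).
Variables (e : seq V) (f : V -> 'rV[K]_(size e)).
Hypothesis f_linear : linear f.
Hypothesis f_ker : forall v, v \in W <-> f v = 0.
Hypothesis f_dual : forall j : 'I_(size e), f e`_j = delta_mx 0 j.

HB.instance Definition _ :=
  GRing.isLinear.Build K V 'rV[K]_(size e) *:%R f f_linear.

(** Subtracting from [v] the combination of [e] with coefficients [f v] leaves a vector killed by
    [f], hence in [W]. *)
Lemma internal_direct_sum_complement :
  internal_direct_sum ([set` W] :: map (@line K V) e).
Proof.
have lineP (k : 'I_(size (map (@line K V) e))) :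
    nth set0 (map (@line K V) e) k = line e`_k.
  by rewrite (nth_map 0) // -(size_map (@line K V)).
pose co (k : 'I_(size (map (@line K V) e))) := cast_ord (size_map _ _) k.
have f_sum (c : 'I_(size (map (@line K V) e)) -> K) k :
    f (\sum_k c k *: e`_k) 0 (co k) = c k.
  rewrite linear_sum summxE (bigD1 k) //= big1 ?addr0 => [|l lk].
    by rewrite linearZ /= (f_dual (co k)) !mxE !eqxx mulr1.
  rewrite linearZ /= (f_dual (co l)) !mxE (inj_eq (@cast_ord_inj _ _ _)).
  by rewrite eq_sym (negPf lk) mulr0.
move=> v; pose p := \sum_k f v 0 (co k) *: e`_k.
(* Index [ord0] carries the component in [W], and [lift ord0 k] the one on the line of the [k]-th
   vector of [e]. *)
pose u : {ffun 'I_(size (map (@line K V) e)).+1 -> V} :=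
  [ffun i => if unlift ord0 i is Some k then f v 0 (co k) *: e`_k else v - p].
have u0 : u ord0 = v - p by rewrite ffunE unlift_none.
have uS k : u (lift ord0 k) = f v 0 (co k) *: e`_k by rewrite ffunE liftK.
exists u; split; first split.
- move=> i; case: (unliftP ord0 i) => [k|] ->; last first.
    rewrite u0 /=; apply/f_ker; rewrite linearB /=; apply/eqP.
    rewrite subr_eq0; apply/eqP/rowP => k.
    by rewrite -[k](cast_ordKV (size_map (@line K V) e)) f_sum.
  by rewrite uS /= lineP; exists (f v 0 (co k)).
- by rewrite big_ord_recl u0 (eq_bigr _ (fun k _ => uS k)) subrK.
(* Uniqueness: [f] kills the [W]-component of [w], so applying it to [v] recovers the coefficients
   on [e], and the [W]-component follows by subtraction. *)
move=> w [wU vE].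
have /f_ker fw0 : w ord0 \in W by exact: (wU ord0).
have wUS k : exists c, w (lift ord0 k) = c *: e`_k.
  by have := wU (lift ord0 k); rewrite /= lineP => -[c _ <-]; exists c.
have [c wS] := boolp.choice wUS.
have vE' : v = w ord0 + \sum_k c k *: e`_k.
  by rewrite vE big_ord_recl (eq_bigr _ (fun k _ => wS k)).
have fv k : f v 0 (co k) = c k by rewrite vE' linearD /= fw0 add0r f_sum.
apply/ffunP => i; case: (unliftP ord0 i) => [k|] ->.
  by rewrite uS wS fv.
by rewrite u0 /p (eq_bigr _ (fun k _ => congr1 (fun c => c *: _) (fv k)))
  vE' addrK.
Qed.

(** [f] descends to the quotient, as its kernel is [W]; the inverse sends a row to the class of the
    combination of [e] with these coefficients. *)
Lemma has_dim_quotmod : has_dim (quotmod W) (size e).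
Proof.
have f_eq x y : f x = f y <-> \pi_(quotmod W) x = \pi_(quotmod W) y.
  split=> [xy|/pi_quotmod_eq/f_ker/eqP].
    by apply/pi_quotmod_eq/f_ker; rewrite linearB /= xy subrr.
  by rewrite linearB subr_eq0 => /eqP.
have f_repr x : f (repr (\pi_(quotmod W) x)) = f x.
  by apply/f_eq; rewrite reprK.
constructor; exists (fun x : quotmod W => f (repr x)).
  move=> c x y; rewrite -[x]reprK -[y]reprK.
  have -> : c *: \pi_(quotmod W) (repr x) + \pi_(quotmod W) (repr y) =
      \pi_(quotmod W) (c *: repr x + repr y).
    by rewrite [RHS]pi_quotmodD pi_quotmodZ.
  by rewrite !f_repr linearP.
pose g (r : 'rV[K]_(size e)) := \pi_(quotmod W) (\sum_j r 0 j *: e`_j).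
exists g => [x|r].
  rewrite /g -[RHS]reprK; apply/f_eq; rewrite linear_sum [RHS]row_sum_delta.
  by apply: eq_bigr => j _; rewrite linearZ /= f_dual.
rewrite /g f_repr linear_sum [RHS]row_sum_delta.
by apply: eq_bigr => j _; rewrite linearZ /= f_dual.
Qed.

End Complement.

(** * Inner and outer derivations of [Tq q] *)

Section OuterDerivations.
Variables (K : fieldType) (q : K).

Local Notation T := (Tq q).
Local Notation a i := (Tq_gen q i).
Local Notation coefs := (nat * nat * nat -> K^o).
Local Notation coord := (@Tq_coord K q).

Lemma ad_derivation (A : algType K) (x : A) :
  (fun y => x * y - y * x) \in @derivation K A.
Proof.
apply/asboolP; split=> [c y z|y z].
  by rewrite mulrDr mulrDl -scalerAr -scalerAl scalerBr opprD addrACA.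
by rewrite mulrBl mulrBr !mulrA addrA subrK.
Qed.

Definition ad (A : algType K) (x : A) : Der A :=
  @Sub _ _ (Der A) _ (ad_derivation x).

Lemma Der_scale (D : Der T) c t : val D (c *: t) = c *: val D t.
Proof.
have D0 : val D 0 = 0.
  by have /esym := Der_linear D (-1) 0 0; rewrite !scaleN1r !addNr.
by have := Der_linear D c t 0; rewrite D0 !addr0.
Qed.

(** The Leibniz rule on both sides of a relation; [c = q] and [c = 1] cover the three defining
    relations. *)
Lemma Der_coord_rel (D : Der T) s t (c : K) : a s * a t = c *: (a t * a s) ->
  rmul_gen q t (coord (val D (a s))) + lmul_gen q s (coord (val D (a t))) =
  c *: (rmul_gen q s (coord (val D (a t))) +
        lmul_gen q t (coord (val D (a s)))).
Proof.
move=> /(congr1 (fun x => coord (val D x))).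
rewrite Der_scale !Der_mul linearZ /= !linearD /=.
by rewrite !Tq_coord_rmul !Tq_coord_lmul.
Qed.

Lemma ad_coord (x : T) s :
  coord (val (ad x) (a s)) = rmul_gen q s (coord x) - lmul_gen q s (coord x).
Proof. by rewrite /= linearB /= Tq_coord_rmul Tq_coord_lmul. Qed.

(** The bidegree [(0, 0)] part of [D], in the order of the five derivations of the theorem. *)
Definition outer_coords (D : Der T) : 'rV[K]_5 :=
  \row_(i < 5) nth 0
    [:: coord (val D (a i11)) (0, 1, 0)%N; coord (val D (a i12)) (1, 0, 0)%N;
        coord (val D (a i22)) (0, 0, 1)%N; coord (val D (a i11)) (0, 0, 1)%N;
        coord (val D (a i22)) (0, 1, 0)%N] i.

Lemma outer_coords_linear : linear outer_coords.
Proof.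
move=> c D E; apply/rowP => i; rewrite !mxE.
have coordP s m : coord (val (c *: D + E) (a s)) m =
    c * coord (val D (a s)) m + coord (val E (a s)) m.
  have -> : val (c *: D + E) (a s) = c *: val D (a s) + val E (a s) by [].
  by rewrite linearP.
by rewrite !coordP; case: i => [[|[|[|[|[|]]]]] //].
Qed.

Section NotRootOfUnity.
Hypothesis q_neq0 : q != 0.
Hypothesis q_not_unity_root : forall n : nat, (0 < n)%N -> ~~ n.-unity_root q.

Lemma expq_neq1 n : (0 < n)%N -> q ^+ n - 1 != 0.
Proof. by move=> /q_not_unity_root; rewrite unity_rootE subr_eq0. Qed.

Lemma expq_neqq n : n != 1%N -> q ^+ n - q != 0.
Proof.
case: n => [_|n].
  by rewrite expr0 subr_eq0 eq_sym -subr_eq0 -[q]expr1 expq_neq1.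
rewrite eqSS => n0; have -> : q ^+ n.+1 - q = q * (q ^+ n - 1).
  by rewrite exprS; ring.
by rewrite mulf_neq0 // expq_neq1 // lt0n.
Qed.

Lemma outer_coords_eq0 (D : Der T) : outer_coords D = 0 -> exists x, D = ad x.
Proof.
move=> D0; have co0 (i : 'I_5) : outer_coords D 0 i = 0 by rewrite D0 mxE.
have rel12 := Der_coord_rel D (Tq_rel1112 q).
have rel32 := Der_coord_rel D (Tq_rel2212 q).
have rel13 : a i11 * a i22 = 1 *: (a i22 * a i11) by rewrite scale1r Tq_rel1122.
have {}rel13 := Der_coord_rel D rel13.
have [rf fP] := Tq_coord_fin (val D (a i11)).
have [rh hP] := Tq_coord_fin (val D (a i12)).
have f010 : coord (val D (a i11)) (0, 1, 0)%N = 0.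
  by have := co0 (@Ordinal 5 0 isT); rewrite mxE.
have h100 : coord (val D (a i12)) (1, 0, 0)%N = 0.
  by have := co0 (@Ordinal 5 1 isT); rewrite mxE.
have g001 : coord (val D (a i22)) (0, 0, 1)%N = 0.
  by have := co0 (@Ordinal 5 2 isT); rewrite mxE.
have f001 : coord (val D (a i11)) (0, 0, 1)%N = 0.
  by have := co0 (@Ordinal 5 3 isT); rewrite mxE.
have g010 : coord (val D (a i22)) (0, 1, 0)%N = 0.
  by have := co0 (@Ordinal 5 4 isT); rewrite mxE.
(* Finite support turns [w] into an element [x], and [D = ad x] need only be checked on the
   generators. *)
suff [w [wfin [wf wh wg]]] : exists w : coefs,
    (exists r : seq (nat * nat * nat), forall m, m \notin r -> w m = 0) /\
    [/\ coord (val D (a i11)) = rmul_gen q i11 w - lmul_gen q i11 w,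
        coord (val D (a i12)) = rmul_gen q i12 w - lmul_gen q i12 w &
        coord (val D (a i22)) = rmul_gen q i22 w - lmul_gen q i22 w].
  have [r wr] := wfin; have [x xw] := Tq_coord_surj q wr.
  exists x; apply: Tq_Der_unique => s; apply: Tq_coord_inj; rewrite ad_coord xw.
  by have [->|->|->] := gen_cases s.
move: rel12 rel32 rel13 fP hP f010 h100 g001 f001 g010.
move: (coord (val D (a i11))) (coord (val D (a i12)))
  (coord (val D (a i22))) => f h g.
move=> rel12 rel32 rel13 fP hP f010 h100 g001 f001 g010.
(* At (0, 0, 0) the quotient is the junk value 0 / 0 = 0, since
   h (1, 0, 0) = 0. *)
pose w : coefs := fun m => let: (j, i, k) := m in
  if j is 0%N then h (1%N, i, k) / (q ^+ (i + k) - 1)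
  else f (j, i.+1, k) / (1 - q ^+ j).
exists w; split.
  (* The images of the two supports under the index shifts in [w]: [.-1] undoes [i.+1], and [0]
     replaces the [1] of [h]. *)
  exists ([seq (m.1.1, m.1.2.-1, m.2) | m <- rf] ++
          [seq (0%N, m.1.2, m.2) | m <- rh]) => -[[j i] k].
  rewrite mem_cat negb_or => /andP[fm hm].
  case: j fm hm => [|j] fm hm.
    rewrite /w hP ?mul0r //; apply: contra hm => hm.
    by apply/mapP; exists (1%N, i, k).
  rewrite /w fP ?mul0r //; apply: contra fm => fm.
  by apply/mapP; exists (j.+1, i.+1, k).
(* The zero and unit terms are kept so that each identity holds by
   conversion. *)
have at_ (F G : coefs) m : F = G -> F m = G m by move->.
(* The digits 1, 2, 3 stand for [a i11], [a i12], [a i22]. A final letter names the only function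
   left at a monomial where one of the two generators is absent. *)
have R13 j i k : f (j, i.+1, k) + q ^+ j * g (j, i, k.+1) =
    1 * (g (j, i, k.+1) + q ^+ j * f (j, i.+1, k)).
  exact: (at_ _ _ (j, i.+1, k.+1) rel13).
have R13f j k : f (j, 0%N, k) + 0 = 1 * (0 + q ^+ j * f (j, 0%N, k)).
  exact: (at_ _ _ (j, 0%N, k.+1) rel13).
have R13g j i : 0 + q ^+ j * g (j, i, 0%N) = 1 * (g (j, i, 0%N) + 0).
  exact: (at_ _ _ (j, i.+1, 0%N) rel13).
have R12 j i k : q ^+ (i.+1 + k) * f (j, i.+1, k) + q ^+ j.+1 * h (j.+1, i, k) =
    q * (h (j.+1, i, k) + f (j, i.+1, k)).
  exact: (at_ _ _ (j.+1, i.+1, k) rel12).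
have R12f j k : q ^+ k * f (j, 0%N, k) + 0 = q * (0 + f (j, 0%N, k)).
  exact: (at_ _ _ (j.+1, 0%N, k) rel12).
have R12h i k : 0 + q ^+ 0 * h (0%N, i, k) = q * (h (0%N, i, k) + 0).
  exact: (at_ _ _ (0%N, i.+1, k) rel12).
have R32 j i k : q ^+ (i + k.+1) * g (j, i, k.+1) + q ^+ j.+1 * h (j.+1, i, k) =
    q * (h (j.+1, i, k) + g (j, i, k.+1)).
  exact: (at_ _ _ (j.+1, i, k.+1) rel32).
have R32g j i : q ^+ (i + 0) * g (j, i, 0%N) + 0 = q * (0 + g (j, i, 0%N)).
  exact: (at_ _ _ (j.+1, i, 0%N) rel32).
have cancel (x y : K) : x != 0 -> x * y = 0 -> y = 0.
  by move=> x0 /eqP; rewrite mulf_eq0 (negPf x0) => /eqP.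
(* At [j = 0] the [h] terms of [R12] cancel, leaving the factor [q ^+ (i + k) - q]. It vanishes only
   for [i + k = 1], where the two values are outer coordinates of [D]. *)
have f0 i k : f (0%N, i, k) = 0.
  have [|] := eqVneq (i + k)%N 1%N.
    by case: i k => [|[|i]] [|[|k]] //; rewrite ?addnS ?addSn.
  move=> /expq_neqq /cancel; apply; case: i => [|i].
    by apply/eqP; rewrite mulrBl subr_eq0 -[X in X == _]addr0 R12f add0r.
  have := R12 0%N i k; rewrite expr1 mulrDr [RHS]addrC => /addIr E.
  by rewrite mulrBl E subrr.
have g0 i k : g (0%N, i, k) = 0.
  have [|] := eqVneq (i + k)%N 1%N.
    by case: i k => [|[|i]] [|[|k]] //; rewrite ?addnS ?addSn.
  move=> /expq_neqq /cancel; apply; case: k => [|k].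
    by apply/eqP; rewrite mulrBl subr_eq0 -[X in X == _]addr0 R32g add0r.
  have := R32 0%N i k; rewrite expr1 mulrDr [RHS]addrC => /addIr E.
  by rewrite mulrBl E subrr.
have h0 i k : h (0%N, i, k) = 0.
  apply: (cancel (1 - q)); first by rewrite -opprB oppr_eq0 -[q]expr1 expq_neq1.
  by have := R12h i k; rewrite mulrBl add0r addr0 expr0 => ->; rewrite subrr.
have qj j : 1 - q ^+ j.+1 != 0 by rewrite -opprB oppr_eq0 expq_neq1.
have f_0 j k : f (j, 0%N, k) = 0.
  case: j => [|j]; first exact: f0.
  apply: (cancel _ _ (qj j)); rewrite mulrBl !mul1r -[X in X - _]addr0 R13f.
  by rewrite mul1r add0r subrr.
have g_0 j i : g (j, i, 0%N) = 0.
  case: j => [|j]; first exact: g0.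
  apply: (cancel _ _ (qj j)); have := R13g j.+1 i.
  by rewrite mulrBl !mul1r add0r addr0 => ->; rewrite subrr.
(* [R13] says that [1 - q ^+ j] kills the difference. Hence the [w] read off from [f] serves [a i22]
   too. *)
have gf j i k : g (j, i, k.+1) = f (j, i.+1, k).
  case: j => [|j]; first by rewrite f0 g0.
  apply/eqP; rewrite -subr_eq0; apply/eqP/(cancel _ _ (qj j)).
  have := R13 j.+1 i k; rewrite mul1r => /eqP; rewrite -subr_eq0 => /eqP E.
  by rewrite -[RHS]oppr0 -E; ring.
have fw j i k : f (j, i.+1, k) = w (j, i, k) - q ^+ j * w (j, i, k).
  case: j => [|j]; first by rewrite expr0 mul1r subrr f0.
  by rewrite -[X in X - _]mul1r -mulrBl mulrC divfK.
split; apply/funext => -[[j i] k]; rewrite -[RHS]/(_ - _).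
- case: i => [|i]; last exact: fw.
  by rewrite f_0 [RHS]subrr.
- case: j => [|j]; first by rewrite h0 [RHS]subrr.
  rewrite /rmul_gen /lmul_gen /=; case: j => [|j].
    (* For [i + k = 0] the commutator has coefficient zero, matching the outer coordinate
       [h (1, 0, 0) = 0]. *)
    have [ik|ik] := posnP (i + k)%N.
      by rewrite ik expr0 mul1r subrr; case: i k ik => [|i] [|k].
    by rewrite -[X in _ - X]mul1r -mulrBl mulrC divfK // expq_neq1.
  (* Here [w] comes from [f], so the equation for [h] has to be derived: cleared of its denominator
     and multiplied by [q], it is [R12]. *)
  rewrite -[X in _ - X]mul1r -mulrBl mulrA.
  apply: (mulIf (qj j)); rewrite divfK //; apply: (mulfI q_neq0).
  have /eqP := R12 j.+1 i k; rewrite addSn !(exprS q (i + k)) (exprS q j.+1).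
  rewrite -subr_eq0 => /eqP E; apply/eqP; rewrite -subr_eq0; apply/eqP.
  by rewrite -[RHS]oppr0 -E; ring.
- case: k => [|k]; last by rewrite gf; exact: fw.
  by rewrite g_0 [RHS]subrr.
Qed.

End NotRootOfUnity.

(** At these five places both multiplications give the constant coefficient of [x] with factor
    [q ^+ 0] or [1], or both give zero. *)
Lemma outer_coords_ad (x : T) : outer_coords (ad x) = 0.
Proof.
apply/rowP => s; rewrite !mxE !ad_coord.
have E (F G : coefs) m : (F - G) m = F m - G m by [].
rewrite !E /rmul_gen /lmul_gen /=.
by case: s => [[|[|[|[|[|]]]]] //= _]; rewrite ?expr0 ?mul1r subrr.
Qed.

Lemma mem_IDer (D : Der T) : D \in IDer T <-> exists x, D = ad x.
Proof.
split=> [/asboolP[x Dx]|[x ->]]; last by apply/asboolP; exists x.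
by exists x; apply: val_inj.
Qed.

(** [Tq_mon] puts [a_11] before [a_12] and [Tq_omon] the reverse; with one of the two absent,
    reordering costs no power of [q]. *)
Lemma Tq_coord_mon i j k : (j == 0)%N || (i == 0)%N ->
  coord (Tq_mon q i j k) = coefs_delta K (j, i, k).
Proof.
move=> ij0; rewrite -(Tq_coord_omon q) /Tq_omon /Tq_mon /=.
congr (coord (_ * _)).
by case/orP: ij0 => /eqP ->; rewrite expr0 ?mulr1 ?mul1r.
Qed.

Lemma outer_coords_dual (j : 'I_5) :
  outer_coords (nth 0
    [:: D11 q; D12 q; D22 q; Dmon q i11 0 0 1; Dmon q i22 1 0 0] j) =
  delta_mx 0 j.
Proof.
have c0 m : coord 0 m = 0 by rewrite linear0.
apply/rowP => s; rewrite !mxE eqxx /=.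
case: j => [[|[|[|[|[|]]]]] //= j5].
- have [-> D0] := D11P q; rewrite !D0 // Tq_coord_mon // !c0.
  by case: s => [[|[|[|[|[|]]]]] s5].
- have [-> D0] := D12P q; rewrite !D0 // Tq_coord_mon // !c0.
  by case: s => [[|[|[|[|[|]]]]] s5].
- have [-> D0] := D22P q; rewrite !D0 // Tq_coord_mon // !c0.
  by case: s => [[|[|[|[|[|]]]]] s5].
- have [-> D0] := D11_001P q; rewrite !D0 // Tq_coord_mon // !c0.
  by case: s => [[|[|[|[|[|]]]]] s5].
- have [-> D0] := D22_100P q; rewrite !D0 // Tq_coord_mon // !c0.
  by case: s => [[|[|[|[|[|]]]]] s5].
Qed.

End OuterDerivations.

Theorem corollary5p2 (K : fieldType) (q : K)
    (char_neq2 : 2%N \notin [pchar K])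
    (q_neq0 : q != 0)
    (q_not_unity_root : forall n : nat, (0 < n)%N -> ~~ n.-unity_root q) :
  internal_direct_sum
    [:: [set` IDer (Tq q)];
        line (D11 q);
        line (D12 q);
        line (D22 q);
        line (Dmon q i11 0 0 1);
        line (Dmon q i22 1 0 0)]
  /\ has_dim (HH1 (Tq q)) 5.
Proof.
pose e := [:: D11 q; D12 q; D22 q; Dmon q i11 0 0 1; Dmon q i22 1 0 0].
have f_ker (D : Der (Tq q)) : D \in IDer (Tq q) <-> outer_coords D = 0.
  split=> [/mem_IDer[x ->]|]; first exact: outer_coords_ad.
  by move=> /(outer_coords_eq0 q_neq0 q_not_unity_root)/mem_IDer.
have f_lin := @outer_coords_linear K q; have f_dual := @outer_coords_dual K q.
split.
  exact: (@internal_direct_sum_complement _ _ _ e _ f_lin f_ker f_dual).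
exact: (@has_dim_quotmod _ _ _ e _ f_lin f_ker f_dual).
Qed.
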